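(* Let $Y$ be a finite graph, let $G$ be a group of order $d$ with an edge-free action on $Y$, let $\mathbb{X}=Y/\!\!/G$ be the quotient graph of groups, and let $\mathfrak{q}$ be a prime of $\mathbb{X}$. Then: 1. The residual degree $f(\mathfrak{p},Y/\mathbb{X})$ of any prime $\mathfrak{p}$ of $Y$ over $\mathfrak{q}$ is equal to the order $f(\mathfrak{q},Y/\mathbb{X})$ of the Frobenius element $F(Q)$ in $G$, where $Q$ is any representative of $\mathfrak{q}$. 2. The length of any prime $\mathfrak{p}$ over $\mathfrak{q}$ is equal to $\ell(\mathfrak{p})=f(\mathfrak{q},Y/\mathbb{X})\,\ell(\mathfrak{q})$. 3. $G$ acts transitively on the primes over $\mathfrak{q}$. 4. The number of primes over $\mathfrak{q}$ is equal to $d/f(\mathfrak{q},Y/\mathbb{X})$.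
   Context: Graphs. A graph (with legs) $X$ consists of vertices $V(X)$, half-edges $H(X)$, a root map $r:H(X)\to V(X)$, and an involution $h\mapsto\overline h$ on $H(X)$. Orbits $\{h,\overline h\}$ of size 2 are edges; half-edges with $\overline h=h$ are legs, forming the set $L(X)$. All graphs are connected. A path of length $n\ge1$ in $X$ is a sequence $h_1\cdots h_n$ of half-edges with $r(h_{j+1})=r(\overline{h_j})$ for $1\le j\le n-1$; it is closed if $r(\overline{h_n})=r(h_1)$; a closed path is reduced if $h_{j+1}\ne\overline{h_j}$ for all $j\in\{1,\dots,n\}$ (indices mod $n$). A closed reduced path is primitive if it is not a power $R^k$, $k\ge2$, of a path. Closed paths are equivalent if they differ by a cyclic shift. A prime is an equivalence class of primitive paths, and its length is the common length of its representatives. Graphs of groups. An edge-trivial graph of groups $\mathbb{X}=(X,X_v)$ is a graph $X$ with a group $X_v$ for each $v\in V(X)$. A path of length $n\ge1$ in $\mathbb{X}$ is $g_0h_1g_1h_2\cdots g_{n-1}h_n$ where $h_1\cdots h_n$ is a path in $X$, $g_0\in X_{r(h_1)}$ and $g_j\in X_{r(\overline{h_j})}$ for $1\le j\le n-1$. It is closed if $h_1\cdots h_n$ is closed; a closed path is reduced if for each $j\in\{1,\dots,n\}$ (indices mod $n$) either $h_{j+1}\ne\overline{h_j}$ or $g_j\ne1$. Primitive paths, equivalence (simultaneous cyclic shift of the $g_{j-1}$ and $h_j$), primes and lengths are defined as for graphs. Quotients. A $G$-action on $Y$ (by bijections of $V(Y)$ and $H(Y)$ commuting with $r$ and the involution)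 is edge-free if $G$ acts freely on $H(Y)$. The quotient graph $X=Y/G$ has $V(X)=V(Y)/G$, $H(X)=H(Y)/G$, with induced root map and involution; $\pi:Y\to X$ is the projection. Choose a spanning tree $T_X\subset X$ and a connected lift $T\subset Y$ of it; for $v\in V(X)$ let $v^T$ be its lift to $T$. The graph of groups $\mathbb{X}=Y/\!\!/G$ has underlying graph $X$ and $X_v=$ stabilizer of $v^T$ in $G$. For each $h\in H(X)$ choose $h^S\in H(Y)$ above $h$ and $F(h)\in G$ as follows. If $h\in H(T_X)$, $h^S$ is its lift to $T$ and $F(h)=1$. For each edge of $X$ not in $T_X$ choose an orientation $(h,\overline h)$ and let $v=r(\overline h)$; choose $h^S$ above $h$ rooted at $r(h)^T$, choose $F(h)\in G$ with $F(h)(v^T)=r(\overline{h^S})$, and set $F(\overline h)=F(h)^{-1}$, $(\overline h)^S=F(\overline h)(\overline{h^S})$. For a leg $l$ of $X$ whose preimages are legs of $Y$, choose a leg $l^S$ above $l$ rooted at $r(l)^T$ and set $F(l)=1$. For a leg $l$ of $X$ whose preimages belong to edges of $Y$, choose an edge $\{h,\overline h\}$ of $Y$ with $\pi(h)=l$, $r(h)=r(l)^T$, set $l^S=h$, and let $F(l)$ be the unique (order 2) element of $G$ sending $h$ to $\overline h$. All these choices are fixed. For $f\in H(Y)$ the sheet number $N(f)\in G$ is the unique element with $N(f)(\pi(f)^S)=f$. The Frobenius element of a path $Q=g_0h_1g_1\cdots g_{n-1}h_n$ in $\mathbb{X}$ is $F(Q)=g_0F(h_1)g_1F(h_2)\cdots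 g_{n-1}F(h_n)\in G$. The image of a closed path $P=f_1\cdots f_n$ in $Y$ is the closed path $\pi(P)=g_0h_1g_1\cdots g_{n-1}h_n$ in $\mathbb{X}$ with $h_j=\pi(f_j)$, $g_j=F(h_j)^{-1}N(f_j)^{-1}N(f_{j+1})$ for $1\le j\le n-1$, and $g_0=F(h_n)^{-1}N(f_n)^{-1}N(f_1)$. If $P$ is primitive in $Y$, then $\pi(P)$ is closed and reduced, so $\pi(P)=Q^f$ for a unique primitive path $Q$ in $\mathbb{X}$; $P$ is said to lie over $Q$ with residual degree $f=f(P,Y/\mathbb{X})$. A prime $\mathfrak p=[P]$ of $Y$ lies over the prime $\mathfrak q=[Q]$ of $\mathbb{X}$ with residual degree $f(\mathfrak p,Y/\mathbb{X})=f$ (independent of the representative $P$). $G$ acts on paths and primes of $Y$ by $g(f_1\cdots f_n)=(gf_1)\cdots(gf_n)$. *)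

(* Defs.v *)
From HB Require Import structures.
From mathcomp Require Import all_fingroup all_boot.
From mathcomp Require Import boolp classical_sets functions cardinality.

Set Implicit Arguments.
Unset Strict Implicit.
Unset Printing Implicit Defensive.

Local Open Scope group_scope.
Local Open Scope quotient_scope.

Record graph := Graph {
  vert : finType;
  half : finType;
  root : half -> vert;
  inv : half -> half;
  invK : involutive inv }.

Definition adj (X : graph) (E : {set half X}) : rel (vert X) :=
  fun u v => [exists h in E, (root h == u) && (root (inv h) == v)].

Definition connected (X : graph) : Prop :=
  forall u v : vert X, connect (adj [set: half X]) u v.

Definition gstep (X : graph) : rel (half X) :=
  fun h h' => root h' == root (inv h).

Definition is_path (X : graph) (P : seq (half X)) : bool :=
  (P != [::]) && sorted (@gstep X) P.

(* [cycle] also relates the last entry to the first one: indices are taken modulo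
   the length. *)
Definition closed_path (X : graph) (P : seq (half X)) : bool :=
  (P != [::]) && cycle (@gstep X) P.

Definition reduced (X : graph) (P : seq (half X)) : bool :=
  closed_path P && cycle (fun h h' => h' != inv h) P.

Definition path_pow (T : Type) (R : seq T) (k : nat) : seq T :=
  flatten (nseq k R).

Definition primitive (X : graph) (P : seq (half X)) : Prop :=
  reduced P /\
  ~ (exists (R : seq (half X)) (k : nat),
        [/\ is_path R, 2 <= k & P = path_pow R k]).

(* A prime is the set of its representatives. *)
Definition cyc_class (T : Type) (P : seq T) : set (seq T) :=
  [set P' | exists k, P' = rot k P]%classic.

Definition is_prime (X : graph) (p : set (seq (half X))) : Prop :=
  exists2 P, primitive P & p = cyc_class P.

Definition prime_length (T : choiceType) (p : set (seq T)) : nat :=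
  size (xget [::] p).

Lemma prime_lengthE (T : choiceType) (P : seq T) :
  prime_length (cyc_class P) = size P.
Proof.
rewrite /prime_length; case: xgetP => [x -> [k ->]|/(_ P)]; first exact: size_rot.
by case; exists 0; rewrite rot0.
Qed.

(* The subgraph with all vertices and the half-edges in E is a tree: it has no
   legs, it is connected, and it contains no closed reduced path. *)
Definition spanning_tree (X : graph) (E : {set half X}) : Prop :=
  [/\ forall h, h \in E -> inv h \in E /\ inv h != h,
      forall u v : vert X, connect (adj E) u v
    & forall c, reduced c -> ~~ all (mem E) c].

(* The vertex groups are subgroups of one ambient group, as they are for the
   quotient graph of groups; membership conditions then replace a dependent type
   of paths. *)
Record graph_of_groups (gT : finGroupType) := GraphOfGroups {
  gog_graph :> graph;
  vgrp : vert gog_graph -> {group gT} }.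

Section GraphOfGroupsPaths.
Variables (gT : finGroupType) (XX : graph_of_groups gT).

(* The path g_0 h_1 g_1 h_2 ... g_{n-1} h_n is the sequence
   (g_0, h_1), (g_1, h_2), ..., (g_{n-1}, h_n).  In a path,
   r(h_{j+1}) = r(inv h_j), so that all conditions on the g_j read
   g_{j-1} \in vgrp (root h_j). *)
Definition gpath : Type := seq (gT * half XX).

Definition gog_mem (Q : gpath) : bool :=
  all (fun x => x.1 \in vgrp (root x.2)) Q.

Definition gog_is_path (Q : gpath) : bool :=
  gog_mem Q && is_path [seq x.2 | x <- Q].

Definition gog_closed_path (Q : gpath) : bool :=
  gog_mem Q && closed_path [seq x.2 | x <- Q].

(* The group element between the half-edges of consecutive entries x, y (with
   the first entry following the last one) is y.1; in particular g_n = g_0. *)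
Definition gog_reduced (Q : gpath) : bool :=
  gog_closed_path Q
  && cycle (fun x y => (y.2 != inv x.2) || (y.1 != 1)) Q.

Definition gog_primitive (Q : gpath) : Prop :=
  gog_reduced Q /\
  ~ (exists (R : gpath) (k : nat),
        [/\ gog_is_path R, 2 <= k & Q = path_pow R k]).

Definition gog_is_prime (q : set gpath) : Prop :=
  exists2 Q, gog_primitive Q & q = cyc_class Q.

End GraphOfGroupsPaths.

(* [action] of MathComp is a right action; the formulas below need left ones. *)
Record laction (gT : finGroupType) (T : Type) := LAction {
  lact :> gT -> T -> T;
  lact1 : forall x, lact 1 x = x;
  lactM : forall a b x, lact (a * b) x = lact a (lact b x) }.

Section Orbits.
Variables (gT : finGroupType) (T : finType) (A : laction gT T).

Definition orbit_rel : rel T := fun x y => [exists g, A g x == y].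

Lemma orbit_rel_refl : reflexive orbit_rel.
Proof. by move=> x; apply/existsP; exists 1; rewrite lact1. Qed.

Lemma orbit_rel_sym : symmetric orbit_rel.
Proof.
suff S x y : orbit_rel x y -> orbit_rel y x by move=> x y; apply/idP/idP; apply: S.
case/existsP=> g /eqP <-; apply/existsP; exists g^-1.
by rewrite -lactM mulVg lact1.
Qed.

Lemma orbit_rel_trans : transitive orbit_rel.
Proof.
move=> y x z /existsP[g /eqP <-] /existsP[k /eqP <-]; apply/existsP.
by exists (k * g); rewrite lactM.
Qed.

Canonical orbit_equiv :=
  EquivRel orbit_rel orbit_rel_refl orbit_rel_sym orbit_rel_trans.

Definition orbit_type : Type := {eq_quot orbit_equiv}.
HB.instance Definition _ := EqQuotient.on orbit_type.
HB.instance Definition _ := Choice.on orbit_type.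
HB.instance Definition _ : isCountable orbit_type :=
  CanIsCountable (@reprK _ orbit_type).
HB.instance Definition _ : isFinite orbit_type :=
  CanIsFinite (@reprK _ orbit_type).

Lemma orbitP x y :
  reflect (exists g, A g x = y) (\pi_orbit_type x == \pi_orbit_type y).
Proof.
rewrite (eqmodE (orbit_equiv) x y).
by apply: (iffP existsP) => -[g] => [/eqP|<-]; exists g.
Qed.

Lemma pi_lact g x : \pi_orbit_type (A g x) = \pi_orbit_type x.
Proof. by apply/esym/eqP/orbitP; exists g. Qed.

Lemma repr_pi_lact x : exists g, repr (\pi_orbit_type x) = A g x.
Proof.
by have /orbitP[g <-] : \pi_orbit_type x == \pi_orbit_type (repr (\pi_orbit_type x));
  [rewrite reprK | exists g].
Qed.

Definition stab (x : T) : {set gT} := [set g | A g x == x].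

Lemma stab_group_set x : group_set (stab x).
Proof.
apply/group_setP; split=> [|a b]; first by rewrite inE lact1.
by rewrite !inE => /eqP Ha /eqP Hb; rewrite lactM Hb Ha.
Qed.

Canonical stab_group x := group (stab_group_set x).

End Orbits.

Record graph_action (gT : finGroupType) (Y : graph) := GraphAction {
  actV : laction gT (vert Y);
  actH : laction gT (half Y);
  act_root : forall g h, root (actH g h) = actV g (root h);
  act_inv : forall g h, inv (actH g h) = actH g (inv h) }.

Definition edge_free (gT : finGroupType) (Y : graph) (A : graph_action gT Y) :
    Prop :=
  forall (g : gT) (h : half Y), actH A g h = h -> g = 1.

Section Quotient.
Variables (gT : finGroupType) (Y : graph) (A : graph_action gT Y).

Definition projV (v : vert Y) : orbit_type (actV A) := \pi v.
Definition projH (h : half Y) : orbit_type (actH A) := \pi h.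

Definition quot_root (h : orbit_type (actH A)) : orbit_type (actV A) :=
  projV (root (repr h)).
Definition quot_inv (h : orbit_type (actH A)) : orbit_type (actH A) :=
  projH (inv (repr h)).

Lemma quot_root_proj h : quot_root (projH h) = projV (root h).
Proof.
rewrite /quot_root /projH; have [g ->] := repr_pi_lact (actH A) h.
by rewrite act_root /projV pi_lact.
Qed.

Lemma quot_inv_proj h : quot_inv (projH h) = projH (inv h).
Proof.
rewrite /quot_inv {2}/projH; have [g ->] := repr_pi_lact (actH A) h.
by rewrite act_inv /projH pi_lact.
Qed.

Lemma quot_invK : involutive quot_inv.
Proof.
move=> h; rewrite /quot_inv -/(quot_inv _) quot_inv_proj invK.
exact: reprK.
Qed.

Definition quot_graph : graph := Graph quot_root quot_invK.

End Quotient.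

Section Choices.
Variables (gT : finGroupType) (Y : graph) (A : graph_action gT Y).
Notation X := (quot_graph A).
Notation pi := (projH A : half Y -> half X).

(* The connected lift T of the tree is given by the vertices v^T and, for
   half-edges of the tree, by h^S: [lift_vT] and [lift_tree] say that these define
   a section of the projection over the tree that is a morphism of graphs. *)
Record choices := Choices {
  tree : {set half X};
  tree_spanning : spanning_tree tree;
  vT : vert X -> vert Y;
  hS : half X -> half Y;
  frob_half : half X -> gT;
  orient : {set half X};
  lift_vT : forall v, projV A (vT v) = v;
  lift_tree : forall h, h \in tree ->
    [/\ pi (hS h) = h, root (hS h) = vT (root h),
        hS (inv h) = inv (hS h) & frob_half h = 1];
  orientP : forall h, h \notin tree -> inv h != h ->
    (inv h \in orient) = (h \notin orient);
  lift_edge : forall h, h \notin tree -> inv h != h -> h \in orient ->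
    [/\ pi (hS h) = h, root (hS h) = vT (root h),
        actV A (frob_half h) (vT (root (inv h))) = root (inv (hS h)),
        frob_half (inv h) = (frob_half h)^-1
      & hS (inv h) = actH A (frob_half (inv h)) (inv (hS h))];
  lift_leg : forall l, inv l = l -> (forall f, pi f = l -> inv f = f) ->
    [/\ pi (hS l) = l, root (hS l) = vT (root l) & frob_half l = 1];
  lift_folded : forall l, inv l = l -> (forall f, pi f = l -> inv f <> f) ->
    [/\ pi (hS l) = l, root (hS l) = vT (root l)
      & actH A (frob_half l) (hS l) = inv (hS l)] }.

Variable C : choices.

Definition quot_gog : graph_of_groups gT :=
  @GraphOfGroups gT X (fun v => stab_group (actV A) (vT C v)).

(* The default value is irrelevant, by [sheetP] and [sheet_unique]. *)
Definition sheet (f : half Y) : gT :=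
  odflt 1 [pick g | actH A g (hS C (pi f)) == f].

Lemma hSP (h : half X) : pi (hS C h) = h /\ root (hS C h) = vT C (root h).
Proof.
have invE k : pi (hS C k) = k -> pi (inv (hS C k)) = inv k.
  by move=> {2}<-; exact/esym/quot_inv_proj.
have [/lift_tree[] //|nt] := boolP (h \in tree C).
have [hl|hl] := eqVneq (inv h) h.
  have [ll|nl] := pselect (forall f, pi f = h -> inv f = f).
    by have [] := @lift_leg C h hl ll.
  have nf : forall f, pi f = h -> inv f <> f.
    move=> f fh ff; apply: nl => k kh.
    have /orbitP[g <-] : pi f == pi k by rewrite fh kh.
    by rewrite act_inv ff.
  by have [] := @lift_folded C h hl nf.
have [ho|ho] := boolP (h \in orient C); first by have [] := @lift_edge C h nt hl ho.
have kt : inv h \notin tree C.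
  apply: contra nt => kt; have [+ _ _] := tree_spanning C.
  by case/(_ _ kt); rewrite invK.
have kl : inv (inv h) != inv h by rewrite invK eq_sym.
have ko : inv h \in orient C by rewrite orientP.
have [p1 p2 p3 p4] := @lift_edge C _ kt kl ko; rewrite invK in p3 p4 *; move=> ->.
rewrite act_root -p3 p4 -lactM mulVg lact1; split=> //.
by rewrite -[RHS]invK -(invE _ p1); exact: pi_lact.
Qed.

Lemma sheetP (f : half Y) : actH A (sheet f) (hS C (pi f)) = f.
Proof.
rewrite /sheet; case: pickP => [g /eqP //|no].
have /orbitP[g gf] : pi (hS C (pi f)) == pi f by rewrite (hSP _).1.
by have := no g; rewrite gf eqxx.
Qed.

Lemma sheet_unique (Afree : edge_free A) (f : half Y) (g : gT) :
  actH A g (hS C (pi f)) = f -> g = sheet f.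
Proof.
move=> gf; apply/eqP; rewrite eq_mulVg1; apply/eqP.
apply: (Afree _ (hS C (pi f))).
by rewrite lactM sheetP -{1}gf -lactM mulVg lact1.
Qed.

Definition frob (Q : gpath quot_gog) : gT :=
  \prod_(x <- Q) (x.1 * frob_half C x.2).

(* [zip (rotr 1 P) P] is the sequence
   (f_n, f_1), (f_1, f_2), ..., (f_{n-1}, f_n). *)
Definition image_path (P : seq (half Y)) : gpath quot_gog :=
  [seq ((frob_half C (pi x.1))^-1 * (sheet x.1)^-1 * sheet x.2, pi x.2)
     | x <- zip (rotr 1 P) P].

Definition path_over (P : seq (half Y)) (Q : gpath quot_gog) (f : nat) : Prop :=
  [/\ primitive P, gog_primitive Q & image_path P = path_pow Q f].

Definition prime_over (p : set (seq (half Y))) (q : set (gpath quot_gog))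
    (f : nat) : Prop :=
  exists P Q, [/\ p = cyc_class P, q = cyc_class Q & path_over P Q f].

Definition primes_over (q : set (gpath quot_gog)) : set (set (seq (half Y))) :=
  [set p | exists f, prime_over p q f]%classic.

Definition act_prime (g : gT) (p : set (seq (half Y))) : set (seq (half Y)) :=
  [set map (actH A g) P | P in p]%classic.

End Choices.

Arguments frob {gT Y A} C Q.
Arguments prime_over {gT Y A} C p q f.
Arguments primes_over {gT Y A} C q.

(* Main.v *)
(** A path of Y is determined by its image in the graph of groups together with
    an element c of G: reading Q = g_0 h_1 g_1 h_2 ... from left to right, the
    lift has the half-edges N_j h_j^S with N_1 = c g_0 and
    N_{j+1} = N_j F(h_j) g_j.  Reading all of Q multiplies c by F(Q), so the lift
    closes up exactly when F(Q) = 1, and reduced closed paths correspond.  Hence,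
    for Q primitive and m the order of F(Q), the primes over [Q] are the classes
    of the lifts of Q^m from the elements c of G; they are primitive because a
    period of Q^m is a multiple of the length of Q.  Two elements c, c' give the
    same class if and only if they lie in the same left coset of <F(Q)>, and G
    acts by left multiplication on c. *)

Require Import Defs.
From HB Require Import structures.
From mathcomp Require Import all_fingroup all_boot.
From mathcomp Require Import boolp classical_sets functions cardinality.
From mathcomp Require cyclic.

Set Implicit Arguments.
Unset Strict Implicit.
Unset Printing Implicit Defensive.

Local Notation half := Defs.half.
Local Notation root := Defs.root.
Local Notation inv := Defs.inv.

(** * Combinatorics of words: powers, rotations and primitivity *)

Section Words.
Variable T : eqType.
Implicit Types (u v w Q R : seq T) (k m n i j : nat).

(** Here [R] is any word, whereas [primitive] and [gog_primitive] speak of paths; [primitiveE] and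
    [gog_primitiveE] reconcile the notions. *)
Definition word_primitive Q : Prop :=
  Q != [::] /\ forall R k, Q = path_pow R k -> k = 1.

Lemma path_powS Q k : path_pow Q k.+1 = Q ++ path_pow Q k.
Proof. by []. Qed.

Lemma path_powD Q m n : path_pow Q (m + n) = path_pow Q m ++ path_pow Q n.
Proof. by rewrite /path_pow nseqD flatten_cat. Qed.

Lemma path_powM Q m n : path_pow Q (m * n) = path_pow (path_pow Q m) n.
Proof. by elim: n => [|n IH]; rewrite ?muln0 // mulnS path_powD IH. Qed.

Lemma path_pow_nil n : path_pow [::] n = [::] :> seq T.
Proof. by elim: n. Qed.

Lemma size_path_pow Q k : size (path_pow Q k) = k * size Q.
Proof. by elim: k => // k IH; rewrite path_powS size_cat IH mulSn. Qed.

Lemma path_powSr Q k : path_pow Q k.+1 = path_pow Q k ++ Q.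
Proof. by rewrite -addn1 path_powD /path_pow /= cats0. Qed.

Lemma rot_iter1 k Q : k <= size Q -> rot k Q = iter k (rot 1) Q.
Proof.
elim: k => [|k IH] ltk; first by rewrite rot0.
by rewrite rotS // IH // ltnW.
Qed.

(** [rot] is truncated at the length, whereas iterates of [rot 1] add up freely; cyclic shifts are
    therefore handled as such iterates. *)
Lemma iter_rot1 i Q : iter i (rot 1) Q = rot (i %% size Q) Q.
Proof.
elim: i => [|i IH]; first by rewrite mod0n rot0.
case: Q IH => [|x Q] IH; first by rewrite iterS IH !rot_oversize.
have lt := ltn_pmod i (isT : 0 < size (x :: Q)).
rewrite iterS IH -(rotS lt) -[i.+1]addn1 -modnDml addn1.
move: lt; rewrite leq_eqVlt => /orP[/eqP e|lt]; last by rewrite (modn_small lt).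
by rewrite e modnn rot_size rot0.
Qed.

Lemma rot1_path_pow Q k : rot 1 (path_pow Q k) = path_pow (rot 1 Q) k.
Proof.
case: Q => [|x Q]; first by rewrite path_pow_nil.
case: k => // k; rewrite path_powS cat_cons !rot1_cons.
elim: k => [|k IH]; first by rewrite /path_pow /= !cats0.
by rewrite rcons_cat [in LHS]path_powS cat_cons rcons_cons IH [in RHS]path_powS cat_rcons.
Qed.

Lemma iter_rot1_path_pow i Q k :
  iter i (rot 1) (path_pow Q k) = path_pow (iter i (rot 1) Q) k.
Proof. by elim: i => //= i ->; rewrite rot1_path_pow. Qed.

(** Euclid's algorithm on words: the shorter word is a prefix of the longer one, and stripping it
    off leaves a shorter commuting pair. *)
Lemma commute_words u v :
  u ++ v = v ++ u -> exists w i j, u = path_pow w i /\ v = path_pow w j.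
Proof.
have [n] := ubnP (size u + size v); elim: n u v => // n IH u v.
wlog le_uv : u v / size u <= size v => [W|] sz uv.
  have [/W/(_ sz uv)//|/ltnW/W] := leqP (size u) (size v).
  by rewrite addnC => /(_ sz (esym uv))[w [i [j []]]]; exists w, j, i.
have [->|nu] := eqVneq u [::].
  by exists v, 0, 1; split=> //; rewrite /path_pow /= cats0.
have ev : v = u ++ drop (size u) v.
  rewrite -{1}(cat_take_drop (size u) v); congr (_ ++ _).
  have := congr1 (take (size u)) uv.
  by rewrite take_size_cat // takel_cat.
move: sz uv; rewrite ev; set v' := drop _ _; clearbody v' => sz uv.
have [||w [i [j [eu ev']]]] := IH u v'.
- move: sz; rewrite size_cat ltnS; apply: leq_trans.
  by rewrite -[X in X < _]add0n ltn_add2r lt0n size_eq0.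
- by move/eqP: uv; rewrite -catA eqseq_cat // eqxx => /eqP.
by exists w, i, (i + j); rewrite path_powD -eu -ev'.
Qed.

Lemma word_primitive_rot1 Q : word_primitive Q -> word_primitive (rot 1 Q).
Proof.
move=> [nQ pQ]; split; first by rewrite -size_eq0 size_rot size_eq0.
(* The remaining [(size Q).-1] shifts bring [rot 1 Q] back to [Q] and carry its root [R] to a root
   of [Q]. *)
move=> R k E; have /pQ// : Q = path_pow (iter (size Q).-1 (rot 1) R) k.
rewrite -iter_rot1_path_pow -E -iterSr prednK ?lt0n ?size_eq0 //.
by rewrite iter_rot1 modnn rot0.
Qed.

Lemma word_primitive_iter_rot1 i Q :
  word_primitive Q -> word_primitive (iter i (rot 1) Q).
Proof. by move=> pQ; elim: i => //= i; apply: word_primitive_rot1. Qed.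

Lemma path_pow_inj Q R n :
  0 < n -> size Q = size R -> path_pow Q n = path_pow R n -> Q = R.
Proof.
case: n => // n _ sz; rewrite !path_powS => /eqP.
by rewrite eqseq_cat // => /andP[/eqP].
Qed.

(* The word [Q] is [A ++ B] with [A] of length [k mod size Q], and the hypothesis says
   that [A] and [B] commute, hence are powers of one word. *)
Lemma word_primitive_period Q n k : word_primitive Q -> 0 < n ->
  k <= size (path_pow Q n) -> rot k (path_pow Q n) = path_pow Q n ->
  size Q %| k.
Proof.
move=> [nQ pQ] n0 lek; rewrite rot_iter1 // iter_rot1_path_pow.
move/path_pow_inj; rewrite iter_rot1 size_rot => /(_ n0 erefl).
have lt : k %% size Q < size Q by rewrite ltn_mod lt0n size_eq0.
have := cat_take_drop (k %% size Q) Q; rewrite /rot /dvdn.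
have := size_takel (ltnW lt); have := size_drop (k %% size Q) Q.
set A := take _ _; set B := drop _ _ => sB sA eQ cQ.
have [w [i [j [eA eB]]]] : exists w i j, A = path_pow w i /\ B = path_pow w j.
  by apply: commute_words; rewrite eQ.
have /pQ : Q = path_pow w (i + j) by rewrite path_powD -eA -eB eQ.
(* Since [i + j = 1], either [A] is empty, which is the claim, or [B] is, which its length
   forbids. *)
case: i eA => [|[|//]] eA; first by rewrite -sA eA.
rewrite -[RHS]addn0 => /addnI j0; move: sB; rewrite eB j0 => /esym/eqP.
by rewrite subn_eq0 leqNgt lt.
Qed.

(** Rotation by [size R] fixes the common power, so [size R] is a multiple of [size Q]. *)
Lemma path_pow_eq Q R n k : word_primitive Q -> 0 < n ->
  path_pow Q n = path_pow R k -> exists2 j, R = path_pow Q j & n = j * k.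
Proof.
move=> pQ n0 eW; have sQ : 0 < size Q by rewrite lt0n size_eq0; case: pQ.
have k0 : 0 < k.
  move: (congr1 size eW); rewrite !size_path_pow; case: k {eW} => //.
  by move/eqP; rewrite mul0n muln_eq0 !eqn0Ngt n0 sQ.
have [||j sR] := dvdnP (word_primitive_period (k := size R) pQ n0 _ _).
- by rewrite eW size_path_pow leq_pmull.
- by rewrite eW -(prednK k0) {1}path_powS rot_size_cat path_powSr.
have en : n = j * k.
  move: (congr1 size eW); rewrite !size_path_pow sR mulnA => /eqP.
  by rewrite eqn_pmul2r // mulnC => /eqP.
exists j => //; apply: (@path_pow_inj _ _ k) => //.
  by rewrite size_path_pow.
by rewrite -path_powM -en eW.
Qed.

End Words.

(** * Cyclic classes, closed words and primitive paths *)

Lemma cyc_classE (T : eqType) (P P' : seq T) :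
  cyc_class P P' <-> exists i, P' = iter i (rot 1) P.
Proof.
split=> -[k ->]; last by exists (k %% size P); rewrite iter_rot1.
have [leP|/ltnW/rot_iter1 ->] := leqP (size P) k; last by exists k.
by exists 0; rewrite rot_oversize.
Qed.

Lemma cyc_class_iter_rot1 (T : eqType) i (P : seq T) :
  cyc_class (iter i (rot 1) P) = cyc_class P.
Proof.
apply/seteqP; split=> P' /cyc_classE[j ->]; apply/cyc_classE.
  by exists (j + i); rewrite iterD.
have [->|P0] := eqVneq P [::]; first by exists 0; rewrite !iter_rot1.
have lt : i %% size P < size P by rewrite ltn_mod lt0n size_eq0.
(* The shift by [i] is undone by completing it to a multiple of the length. *)
exists (j + (size P - i %% size P)); rewrite iterD; congr (iter j _ _).
rewrite -iterD iter_rot1 -modnDmr subnK ?modnn ?rot0 //; exact: ltnW.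
Qed.

Lemma cyc_class_refl (T : Type) (P : seq T) : cyc_class P P.
Proof. by exists 0; rewrite rot0. Qed.

Lemma cycle_path_pow (T : eqType) (e : rel T) (Q : seq T) k :
  cycle e Q -> cycle e (path_pow Q k).
Proof.
case: Q => [|x Q]; first by rewrite path_pow_nil.
rewrite !(cycle_path x) /= => eQ; have eQk j : path e (last x Q) (path_pow (x :: Q) j).
  by elim: j => // j; rewrite path_powS cat_path /= => ->; rewrite eQ.
by case: k => // k; rewrite path_powSr last_cat -path_powSr; apply: eQk.
Qed.

Lemma cycle_path_pow_sorted (T : eqType) (e : rel T) (R : seq T) k :
  0 < k -> cycle e (path_pow R k) -> sorted e R.
Proof.
case: k R => [|k] [|x R] // _.
by rewrite path_powS /= rcons_cat cat_path => /andP[].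
Qed.

(** Lets a condition on single entries be merged by [cycle_relI] with conditions on consecutive
    ones. *)
Lemma cycle_all (T : Type) (p : pred T) (s : seq T) :
  cycle (fun _ y => p y) s = all p s.
Proof.
have E x r : path (fun _ y => p y) x r = all p r by elim: r x => //= y r IH x; rewrite IH.
by case: s => //= x s; rewrite E all_rcons.
Qed.

(** A root of a closed path is itself a path, so requiring [R] to be one excludes no root. *)
Lemma primitiveE (X : graph) (P : seq (half X)) :
  primitive P <-> reduced P /\ word_primitive P.
Proof.
split=> -[rP pP]; split=> //; last first.
  by case=> R [k [_ k2 eP]]; move: k2; rewrite (pP.2 _ _ eP).
have /andP[/andP[P0 cP] _] := rP; split=> // R k eP.
case: k eP => [|[//|k]] eP; first by rewrite eP in P0.
case: pP; exists R, k.+2; split=> //; apply/andP; split.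
  by apply: contraNneq P0 => R0; rewrite eP R0 path_pow_nil.
by apply: (@cycle_path_pow_sorted _ _ _ k.+2); rewrite -?eP.
Qed.

Section GraphOfGroups.
Variables (gT : finGroupType) (XX : graph_of_groups gT).
Implicit Types Q R : gpath XX.

Lemma gog_primitiveE Q :
  gog_primitive Q <-> gog_reduced Q /\ word_primitive Q.
Proof.
split=> -[rQ pQ]; split=> //; last first.
  by case=> R [k [_ k2 eQ]]; move: k2; rewrite (pQ.2 _ _ eQ).
have /andP[/and3P[mQ Q0 cQ] _] := rQ.
have {}Q0 : Q != [::] by move: Q0; case: (Q).
split=> // R k eQ; case: k eQ => [|[//|k]] eQ; first by rewrite eQ in Q0.
case: pQ; exists R, k.+2; split=> //; apply/and3P; split.
- by move: mQ; rewrite eQ /gog_mem path_powS all_cat => /andP[].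
- apply: contraNneq Q0 => R0; rewrite eQ.
  by case: (R) R0 => //; rewrite path_pow_nil.
- by move: cQ; rewrite cycle_map sorted_map eQ; apply: cycle_path_pow_sorted.
Qed.

(** Membership is asked of the later entry only: in a cycle every entry is the later one of some
    pair. *)
Definition gog_step : rel (gT * half XX) := fun x y =>
  [&& y.1 \in vgrp (root y.2), gstep x.2 y.2
    & (y.2 != inv x.2) || (y.1 != 1%g)].

Lemma gog_reducedE Q : gog_reduced Q = (Q != [::]) && cycle gog_step Q.
Proof.
rewrite /gog_reduced /gog_closed_path /closed_path cycle_map /gog_mem.
rewrite -[all _ _]cycle_all.
have -> : ([seq x.2 | x <- Q] != [::]) = (Q != [::]) by case: (Q).
by rewrite -!andbA andbCA -!cycle_relI.
Qed.

Lemma gog_primitive_iter_rot1 i Q :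
  gog_primitive Q -> gog_primitive (iter i (rot 1) Q).
Proof.
move=> /gog_primitiveE[rQ pQ]; apply/gog_primitiveE.
split; last exact: word_primitive_iter_rot1.
elim: i => //= i; rewrite !gog_reducedE rot_cycle.
by rewrite -!size_eq0 size_rot.
Qed.

End GraphOfGroups.

Definition reduced_step (X : graph) : rel (half X) :=
  fun h h' => gstep h h' && (h' != inv h).

Lemma reducedE (X : graph) (P : seq (half X)) :
  reduced P = (P != [::]) && cycle (@reduced_step X) P.
Proof. by rewrite /reduced /closed_path -andbA -cycle_relI. Qed.

(** * Lifting paths to [Y] and taking images in the graph of groups *)

Section Lifts.
Local Open Scope group_scope.
Variables (gT : finGroupType) (Y : graph) (A : graph_action gT Y).
Hypothesis Afree : edge_free A.
Variable C : choices A.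
Notation X := (quot_graph A).
Notation XX := (quot_gog C).
Implicit Types (Q R : gpath XX) (P : seq (half Y)) (c g : gT).

Lemma proj_hS c (h : half X) : projH A (actH A c (hS C h)) = h.
Proof. by rewrite /projH pi_lact; exact: (hSP C h).1. Qed.

Lemma sheet_hS c (h : half X) : sheet C (actH A c (hS C h)) = c.
Proof. by apply/esym/sheet_unique => //; rewrite proj_hS. Qed.

Lemma act_hS_inj c c' (h : half X) :
  actH A c (hS C h) = actH A c' (hS C h) -> c = c'.
Proof. by move/(congr1 (sheet C)); rewrite !sheet_hS. Qed.

(* The common content of the four cases in the construction of [hS] and [frob_half]. *)
Lemma frob_half_hS (h : half X) :
  actH A (frob_half C h) (hS C (inv h)) = inv (hS C h).
Proof.
have [/(@lift_tree _ _ _ C)[_ _ -> ->]|nt] := boolP (h \in tree C); first by rewrite lact1.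
have [hl|hl] := eqVneq (inv h) h.
  rewrite hl; have [ll|nl] := pselect (forall f, projH A f = h -> inv f = f).
    have [p _ ->] := @lift_leg _ _ _ C h hl ll.
    by rewrite lact1 ll.
  have nf : forall f, projH A f = h -> inv f <> f.
    move=> f fh ff; apply: nl => k kh.
    have /Defs.orbitP[g <-] : projH A f == projH A k by rewrite fh kh.
    by rewrite act_inv ff.
  by have [] := @lift_folded _ _ _ C h hl nf.
have [ho|ho] := boolP (h \in orient C).
  have [_ _ _ e ->] := @lift_edge _ _ _ C h nt hl ho.
  by rewrite e -lactM mulgV lact1.
have kt : inv h \notin tree C.
  apply: contra nt => kt; have [+ _ _] := tree_spanning C.
  by case/(_ _ kt); rewrite Defs.invK.
have kl : inv (inv h) != inv h by rewrite Defs.invK eq_sym.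
have ko : inv h \in orient C by rewrite orientP.
have [_ _ _ _] := @lift_edge _ _ _ C _ kt kl ko; rewrite Defs.invK => ->.
by rewrite act_inv Defs.invK.
Qed.

Fixpoint lift_path c (Q : gpath XX) : seq (half Y) :=
  if Q is x :: Q' then
    actH A (c * x.1) (hS C x.2) :: lift_path (c * x.1 * frob_half C x.2) Q'
  else [::].

Lemma frob_cons x Q : frob C (x :: Q) = x.1 * frob_half C x.2 * frob C Q.
Proof. by rewrite /frob big_cons. Qed.

Lemma frob_cat Q R : frob C (Q ++ R) = frob C Q * frob C R.
Proof. by rewrite /frob big_cat. Qed.

Lemma frob_path_pow Q k : frob C (path_pow Q k) = frob C Q ^+ k.
Proof.
elim: k => [|k IH]; first by rewrite /frob /path_pow /= big_nil expg0.
by rewrite path_powS frob_cat IH expgS.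
Qed.

Lemma size_lift_path c Q : size (lift_path c Q) = size Q.
Proof. by elim: Q c => //= x Q IH c; rewrite IH. Qed.

Lemma lift_path_cat c Q R : lift_path c (Q ++ R) = lift_path c Q ++ lift_path (c * frob C Q) R.
Proof.
elim: Q c => [|x Q IH] c /=; first by rewrite /frob big_nil mulg1.
by rewrite IH frob_cons !mulgA.
Qed.

Lemma lift_path_path_pow c Q k :
  frob C Q = 1 -> lift_path c (path_pow Q k) = path_pow (lift_path c Q) k.
Proof. by move=> F1; elim: k => // k IH; rewrite !path_powS lift_path_cat F1 mulg1 IH. Qed.

Lemma map_act_lift_path g c Q : map (actH A g) (lift_path c Q) = lift_path (g * c) Q.
Proof. by elim: Q c => //= x Q IH c; rewrite IH -lactM !mulgA. Qed.

Lemma lift_path_inj c c' Q : Q != [::] -> lift_path c Q = lift_path c' Q -> c = c'.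
Proof. by case: Q => //= x Q _ [/act_hS_inj/mulIg]. Qed.

Definition image_step (f f' : half Y) : gT * half XX :=
  ((frob_half C (projH A f))^-1 * (sheet C f)^-1 * sheet C f', projH A f').

(** Replaces the rotated [zip] by a recursion along [P], started at its last half-edge because
    indices are cyclic. *)
Lemma image_pathE f P : image_path C P = pairmap image_step (last f P) P.
Proof.
have E x s : [seq image_step y.1 y.2 | y <- zip (belast x s) s] = pairmap image_step x s.
  by elim: s x => //= y s IH x; rewrite IH.
by case: P => // x P; rewrite /image_path {1}lastI rotr1_rcons -(E (last x P)).
Qed.

Lemma image_path_pow P k : image_path C (path_pow P k) = path_pow (image_path C P) k.
Proof.
case: P => [|x P]; first by rewrite !path_pow_nil.
case: k => // k; rewrite !(image_pathE x) path_powSr last_cat -path_powSr.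
by elim: k.+1 => // j IH; rewrite !path_powS pairmap_cat -IH.
Qed.

Lemma image_path_iter_rot1 i P :
  image_path C (iter i (rot 1) P) = iter i (rot 1) (image_path C P).
Proof.
elim: i => //= i <-; case: (iter i _ P) => // x s.
rewrite rot1_cons !(image_pathE x) last_rcons /= rot1_cons.
by rewrite -!cats1 pairmap_cat.
Qed.

(** The element from which [lift_path] continues after producing the half-edge [f]. *)
Notation state f := (sheet C f * frob_half C (projH A f)).

(** The inverses in [image_step] cancel the state of the previous half-edge and leave the sheet
    number of the next. *)
Lemma lift_pairmap f P : lift_path (state f) (pairmap image_step f P) = P.
Proof.
elim: P f => //= f' P IH f.
by rewrite !mulgA mulgK mulgV mul1g sheetP IH.
Qed.

Lemma frob_pairmap f P :
  state f * frob C (pairmap image_step f P) = state (last f P).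
Proof.
elim: P f => [|f' P IH] f; first by rewrite /frob big_nil mulg1.
by rewrite /= frob_cons /= -IH !mulgA mulgK mulgV mul1g.
Qed.

(** The product telescopes, and it begins and ends at the state of the last half-edge. *)
Lemma frob_image_path P : frob C (image_path C P) = 1.
Proof.
case: P => [|x P]; first by rewrite /frob big_nil.
by apply: (mulgI (state (last x P))); rewrite (image_pathE x) frob_pairmap mulg1.
Qed.

Lemma lift_image_path P : exists c, lift_path c (image_path C P) = P.
Proof.
case: P => [|x P]; first by exists 1.
by exists (state (last x P)); rewrite (image_pathE x) lift_pairmap.
Qed.

Lemma pairmap_lift_path f Q : pairmap image_step f (lift_path (state f) Q) = Q.
Proof.
elim: Q f => //= -[g h] Q IH f; rewrite {1}/image_step proj_hS sheet_hS /=.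
congr ((_, _) :: _); first by rewrite !mulgA mulgKV mulVg mul1g.
by rewrite -[RHS](IH (actH A (state f * g) (hS C h))) proj_hS sheet_hS.
Qed.

(** The first entry is read from the last half-edge of the lift, whose state is [c * frob C Q], that
    is, [c]. *)
Lemma image_lift_path c Q : frob C Q = 1 -> image_path C (lift_path c Q) = Q.
Proof.
move=> F1; case: Q F1 => // x Q F1.
rewrite (image_pathE (hS C x.2)); set f := last _ _.
suff ec : state f = c by rewrite -ec pairmap_lift_path.
rewrite /f /= -frob_pairmap; set f1 := actH _ _ _.
have -> : c * x.1 * frob_half C x.2 = state f1 by rewrite proj_hS sheet_hS.
by rewrite pairmap_lift_path proj_hS sheet_hS -[RHS]mulg1 -F1 frob_cons !mulgA.
Qed.

(** By [frob_half_hS], the inverse of [c] times the lift of [h] is [c * frob_half C h] times the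
    lift of [inv h]. The roots match because [g'] fixes its base vertex, and a backtrack would force
    [h' = inv h] and, by freeness, [g' = 1]. *)
Lemma reduced_step_lift_path c (x y : gT * half XX) :
  gog_step x y ->
  reduced_step (actH A c (hS C x.2))
    (actH A (c * frob_half C x.2 * y.1) (hS C y.2)).
Proof.
case: x y => [g h] [g' h'] /and3P[/= + /eqP r n]; rewrite inE => /eqP s.
have {}s : actV A g' (vT C (root (h' : half X))) = vT C (root (h' : half X)) := s.
have {}r : root (h' : half X) = root (inv (h : half X)) := r.
rewrite /reduced_step /gstep act_inv -frob_half_hS -[actH A c _]lactM.
rewrite !act_root (hSP C h').2 (hSP C (inv h)).2 lactM s r eqxx /=.
apply: contraTneq n => e; have := congr1 (projH A) e.
rewrite !proj_hS => eh; move: e; rewrite eh => /act_hS_inj.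
by rewrite -[RHS]mulg1 => /mulgI ->; rewrite !eqxx.
Qed.

Lemma reduced_lift_path c Q : frob C Q = 1 -> gog_reduced Q -> reduced (lift_path c Q).
Proof.
rewrite gog_reducedE reducedE; case: Q => //= x Q F1.
have E d z R : path (@gog_step _ XX) z R ->
    path (@reduced_step Y) (actH A d (hS C z.2)) (lift_path (d * frob_half C z.2) R).
  elim: R z d => //= y R IH z d /andP[zy yR].
  by rewrite reduced_step_lift_path //= IH.
(* The cycle is a path that ends by reading [x] once more; as [F1] restores [c], this lifts to the
   first half-edge again. *)
move/(E (c * x.1)); rewrite -cats1 lift_path_cat /= cats1.
suff -> : c * x.1 * frob_half C x.2 * frob C Q = c by [].
by rewrite -[RHS]mulg1 -F1 frob_cons !mulgA.
Qed.

(** * The primes over the class of a fixed primitive path *)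

Section Over.
Variable Q : gpath XX.
Hypothesis Qprim : gog_primitive Q.
Let m := #[frob C Q].
Let m_gt0 : 0 < m := fingroup.order_gt0 _.

Lemma frob_pow_order : frob C (path_pow Q m) = 1.
Proof. by rewrite frob_path_pow expg_order. Qed.

(** If the lift is [R] to the power [k], the image of [R] is a power of [Q] with exponent [j], where
    [m = j * k]. Its Frobenius element is trivial, so [m] divides [j] and [k = 1]. *)
Lemma primitive_lift_path c : primitive (lift_path c (path_pow Q m)).
Proof.
have [rQ pQ] := (gog_primitiveE Q).1 Qprim.
have Qm0 : path_pow Q m != [::].
  by rewrite -size_eq0 size_path_pow muln_eq0 negb_or -lt0n m_gt0 size_eq0; case: pQ.
apply/primitiveE; split.
  apply: reduced_lift_path frob_pow_order _; move: rQ; rewrite !gog_reducedE Qm0 /=.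
  by move=> /andP[_]; apply: cycle_path_pow.
split; first by rewrite -size_eq0 size_lift_path size_eq0.
move=> R k /(congr1 (image_path C)); rewrite image_path_pow image_lift_path ?frob_pow_order //.
case/(path_pow_eq pQ m_gt0) => j eR em.
have : m %| j by rewrite /m cyclic.order_dvdn -frob_path_pow -eR frob_image_path.
have := m_gt0; rewrite em muln_gt0 => /andP[j0 k0] /(dvdn_leq j0).
by rewrite -[leqRHS]muln1 leq_pmul2l // => k1; apply/eqP; rewrite eqn_leq k1.
Qed.

Lemma path_over_lift_path c : path_over (lift_path c (path_pow Q m)) Q m.
Proof.
split=> //; first exact: primitive_lift_path.
by rewrite image_lift_path // frob_pow_order.
Qed.

(** Images have trivial Frobenius element, so [m] divides [f]. The path is then a power of a lift of
    [path_pow Q m], and its primitivity leaves only [f = m]. *)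
Lemma prime_over_lift_path p f : prime_over C p (cyc_class Q) f ->
  f = m /\ exists c, p = cyc_class (lift_path c (path_pow Q m)).
Proof.
case=> P [Q' [-> eQ [/primitiveE[_ pP] _ iP]]].
have /cyc_classE[i Qi] : cyc_class Q' Q by rewrite -eQ; apply: cyc_class_refl.
(* [P] lies over a shift [Q'] of [Q]; shifting [P] accordingly puts it over [Q] itself. *)
rewrite -(cyc_class_iter_rot1 i P).
have := word_primitive_iter_rot1 i pP; have := image_path_iter_rot1 i P.
rewrite iP iter_rot1_path_pow -Qi; move: (iter i _ P) => {P iP pP} P iP pP.
have [c eP] := lift_image_path P; rewrite iP in eP.
have /dvdnP[j fj] : m %| f by rewrite /m cyclic.order_dvdn -frob_path_pow -iP frob_image_path.
have j1 : j = 1%N.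
  apply: (pP.2 (lift_path c (path_pow Q m))); rewrite -lift_path_path_pow ?frob_pow_order //.
  by rewrite -path_powM mulnC -fj.
move: fj; rewrite j1 mul1n => fm; split=> //.
by exists c; rewrite -fm eP.
Qed.

Lemma primes_overE :
  primes_over C (cyc_class Q) =
    range (fun c => cyc_class (lift_path c (path_pow Q m))).
Proof.
apply/seteqP; split=> [p [f /prime_over_lift_path[_ [c ->]]]|_ [c _ <-]]; first by exists c.
by exists m, (lift_path c (path_pow Q m)), Q; split=> //; apply: path_over_lift_path.
Qed.

(** After [j] copies of [Q] the lift continues from [c * frob C Q ^+ j]; the copies moved to the end
    fit there because the [m]-th power of [frob C Q] is trivial. *)
Lemma rot_lift_path c j : j <= m ->
  rot (j * size Q) (lift_path c (path_pow Q m)) = lift_path (c * frob C Q ^+ j) (path_pow Q m).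
Proof.
move=> jm; rewrite -{1}(subnKC jm) path_powD lift_path_cat.
rewrite -size_path_pow -(size_lift_path c) rot_size_cat -{2}(subnK jm) path_powD lift_path_cat.
by rewrite !frob_path_pow -mulgA -expgD subnKC // expg_order mulg1.
Qed.

Lemma cyc_class_lift_eq c c' :
  cyc_class (lift_path c (path_pow Q m)) = cyc_class (lift_path c' (path_pow Q m)) <->
  c *: <[frob C Q]> = c' *: <[frob C Q]>.
Proof.
have [_ pQ] := (gog_primitiveE Q).1 Qprim.
have sQ : 0 < size Q by rewrite lt0n size_eq0; case: pQ.
split=> [ecc|/lcoset_eqP/lcosetP[y /cyclePmin[j jm ->] ->]]; last first.
  by rewrite -rot_lift_path ?(ltnW jm) // rot_iter1 ?cyc_class_iter_rot1 //
    size_lift_path size_path_pow leq_pmul2r // ltnW.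
have [k lek ek] : exists2 k, k <= size (path_pow Q m) &
    lift_path c (path_pow Q m) = rot k (lift_path c' (path_pow Q m)).
  have [k ->] : cyc_class (lift_path c' (path_pow Q m)) (lift_path c (path_pow Q m)).
    by rewrite -ecc; apply: cyc_class_refl.
  rewrite -(size_lift_path c'); have [lek|/ltnW lek] := leqP k (size (lift_path c' (path_pow Q m))).
    by exists k.
  by exists 0%N => //; rewrite rot0 rot_oversize.
(* Both lifts have image [path_pow Q m], so the shift between them fixes it and, by primitivity of
   [Q], runs through whole copies of [Q]. *)
have : rot k (path_pow Q m) = path_pow Q m.
  rewrite -{2}(@image_lift_path c _ frob_pow_order) ek.
  rewrite [X in image_path C X]rot_iter1 ?size_lift_path //.
  by rewrite image_path_iter_rot1 image_lift_path ?frob_pow_order // -rot_iter1.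
case/(word_primitive_period pQ m_gt0 lek)/dvdnP => j kj.
move: lek ek; rewrite kj size_path_pow leq_pmul2r // => jm; rewrite rot_lift_path //.
move=> /lift_path_inj ->.
  by apply/lcoset_eqP/lcosetP; exists (frob C Q ^+ j); rewrite ?mem_cycle.
by rewrite -size_eq0 size_path_pow -lt0n muln_gt0 m_gt0.
Qed.

End Over.

Lemma act_prime_lift_path g c Q :
  act_prime A g (cyc_class (lift_path c Q)) = cyc_class (lift_path (g * c) Q).
Proof.
rewrite -map_act_lift_path; apply/seteqP; split=> [_ [_ [k ->] <-]|_ [k ->]].
  by exists k; rewrite map_rot.
by exists (rot k (lift_path c Q)); [exists k | rewrite map_rot].
Qed.

End Lifts.

Theorem theorem4p9 (Y : graph) (hY : connected Y)
    (gT : finGroupType) (d : nat) (hd : #|gT| = d)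
    (A : graph_action gT Y) (hA : edge_free A)
    (C : choices A) (q : set (gpath (quot_gog C))) (hq : gog_is_prime q) :
  forall Q : gpath (quot_gog C), q Q ->
  [/\ forall p f, prime_over C p q f -> f = #[frob C Q]%g,
      forall p, primes_over C q p ->
        prime_length p = #[frob C Q]%g * prime_length q,
      (forall g p, primes_over C q p -> primes_over C q (act_prime A g p)) /\
      (forall p p', primes_over C q p -> primes_over C q p' ->
         exists g : gT, p' = act_prime A g p)
    & (primes_over C q #= `I_(d %/ #[frob C Q]%g))%card].
Proof.
move=> Q qQ; have [Qprim ->] : gog_primitive Q /\ q = cyc_class Q.
  case: hq qQ => Q0 pQ0 -> /cyc_classE[i ->].
  by rewrite cyc_class_iter_rot1; split=> //; apply: gog_primitive_iter_rot1.
split.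
- by move=> p f /prime_over_lift_path[].
- move=> p; rewrite primes_overE // => -[c _ <-].
  by rewrite !prime_lengthE size_lift_path size_path_pow.
- rewrite primes_overE //; split=> [g _ [c _ <-]|_ _ [c _ <-] [c' _ <-]].
    by exists (g * c)%g => //; rewrite act_prime_lift_path.
  by exists (c' * c^-1)%g; rewrite act_prime_lift_path mulgKV.
(* The primes are parametrized injectively by the left cosets, through chosen representatives, and
   Lagrange's theorem counts the cosets. *)
- set L := lcosets <[frob C Q]>%g [set: gT].
  pose w c := cyc_class (lift_path c (path_pow Q #[frob C Q]%g)).
  have reprL (B : {set gT}) : B \in L -> (fingroup.repr B *: <[frob C Q]>)%g = B.
    by case/lcosetsP=> x _ ->; apply/lcoset_eqP/(mem_repr x)/lcoset_refl.
  have -> : primes_over C (cyc_class Q) =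
      [set w (fingroup.repr (enum_val i)) | i in [set: 'I_#|L|]]%classic.
    rewrite primes_overE //; apply/seteqP; split=> [_ [c _ <-]|_ [i _ <-]]; last by eexists.
    have cL : (c *: <[frob C Q]>)%g \in L by apply/lcosetsP; exists c.
    exists (enum_rank_in cL (c *: <[frob C Q]>)%g) => //.
    by rewrite enum_rankK_in //; apply/cyc_class_lift_eq => //; rewrite reprL.
  have -> : d %/ #[frob C Q]%g = #|L|.
    by rewrite card_lcosets -divgS ?finset.subsetT // finset.cardsT hd.
  apply: card_eq_trans (card_esym card_II); apply: inj_card_eq => i j _ _ /=.
  move/(cyc_class_lift_eq hA Qprim); rewrite !reprL ?enum_valP //.
  exact: enum_val_inj.
Qed.
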